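(* If $\varphi_e$ and $\varphi_{e_1}$ form a Mannheim surface offset, then the relationship between the conical curvature $\gamma_1$ of $\varphi_{e_1}$ and the offset angle $\theta$ is given by $$\gamma_1=-\tanh\theta.$$
   Context: Minkowski space $\mathbb{R}^3_1$ is $\mathbb{R}^3$ with $\langle \vec a,\vec b\rangle=-a_1b_1+a_2b_2+a_3b_3$, and the Lorentzian cross product is $\vec a\times\vec b=(a_2b_3-a_3b_2,\ a_1b_3-a_3b_1,\ a_2b_1-a_1b_2)$. Dual numbers are $a+\varepsilon a^*$ with $a,a^*\in\mathbb{R}$, $\varepsilon^2=0$; dual vectors are $\vec a+\varepsilon\vec a^*$ with $\vec a,\vec a^*\in\mathbb{R}^3_1$; inner and cross products extend bilinearly over the dual numbers. A differentiable real function $f$ extends to dual numbers by $f(x+\varepsilon x^* )=f(x)+\varepsilon x^*f'(x)$. First surface (spacelike ruled surface): $\varphi_e(s,v)=\vec c(s)+v\,\vec e(s)$ with smooth $\vec c,\vec e$ on an interval containing $0$, $\langle\vec e,\vec e\rangle=1$, $\langle\vec e\,',\vec e\,'\rangle=-1$, $\langle\vec c\,',\vec e\,'\rangle=0$ (prime is $d/ds$; $s$ is the arc-length of the indicatrix $\vec e$, and $\vec c$ is the striction curve). Put $\vec t=\vec e\,'$, $\vec g=-\vec e\times\vec t$; then $\vec t\,'=\vec e+\gamma\vec g$, $\vec g\,'=\gamma\vec t$, which defines the conical curvature $\gamma$. Put $\Delta=\det(\vec c\,',\vec e,\vec t)$, $\delta=\langle\vec c\,',\vec e\rangle$, and $\tilde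 x=\vec x+\varepsilon\,\vec c\times\vec x$ for $\vec x=\vec e,\vec t,\vec g$. The dual arc-length is $\bar s=s+\varepsilon s^*$, $s^*=\int_0^s\Delta\,du$. The dual Darboux frame $\{\tilde e,\tilde t,\tilde g\}$ satisfies $\frac{d\tilde e}{d\bar s}=\tilde t$, $\frac{d\tilde t}{d\bar s}=\tilde e+\bar\gamma\tilde g$, $\frac{d\tilde g}{d\bar s}=\bar\gamma\tilde t$ with $\bar\gamma=\gamma-\varepsilon(\delta+\gamma\Delta)$. Second surface (timelike ruled surface with timelike rulings): $\varphi_{e_1}(s_1,v)=\vec c_1(s_1)+v\,\vec e_1(s_1)$ with $\langle\vec e_1,\vec e_1\rangle=-1$, $s_1$ the arc-length of the indicatrix $\vec e_1$, $\vec t_1=\frac{d\vec e_1}{ds_1}$ with $\langle\vec t_1,\vec t_1\rangle=1$, $\langle\frac{d\vec c_1}{ds_1},\vec t_1\rangle=0$ ($\vec c_1$ is the striction curve). Put $\Delta_1=\det(\frac{d\vec c_1}{ds_1},\vec e_1,\vec t_1)$. Its dual arc-length is $\bar s_1=s_1+\varepsilon s_1^*$, $s_1^*=-\int_0^{s_1}\Delta_1du_1$. Its dual Darboux frame is $\{\tilde e_1,\tilde t_1,\tilde g_1\}$, $\tilde x_1=\vec x_1+\varepsilon\,\vec c_1\times\vec x_1$, with $\tilde t_1=\frac{d\tilde e_1}{d\bar s_1}$. Its conical curvature is $\gamma_1=-\langle\frac{d\vec g_1}{ds_1},\vec t_1\rangle$. Mannheim offsets: $\varphi_e$ and $\varphi_{e_1}$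 (with corresponding points, $s_1$ being a regular function of $s$, i.e. $\frac{ds_1}{ds}\neq0$) form a Mannheim surface offset if $\tilde g(\bar s)=\tilde t_1(\bar s_1)$. The frames are then related by $$\tilde e_1=\sinh\bar\theta\,\tilde e+\cosh\bar\theta\,\tilde t,\quad \tilde t_1=\tilde g,\quad \tilde g_1=\cosh\bar\theta\,\tilde e+\sinh\bar\theta\,\tilde t,$$ where the dual function $\bar\theta=\theta+\varepsilon\theta^*$ is the dual Lorentzian offset angle; the real functions $\theta$ and $\theta^*$ are called the offset angle and the offset distance. Quantities of the two surfaces are compared at corresponding parameters $s$, $s_1$. *)

(* Defs.v *)
(* Stdlib reals with Coquelicot. *)
From Stdlib Require Import Reals.
From Coquelicot Require Import Coquelicot.
Open Scope R_scope.

(* Minkowski 3-space: the vector space R^3, with signature (-,+,+). *)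
Definition vec : Type := (R * R * R)%type.
Definition x1 (a : vec) : R := fst (fst a).
Definition x2 (a : vec) : R := snd (fst a).
Definition x3 (a : vec) : R := snd a.

Definition inner (a b : vec) : R :=
  - (x1 a * x1 b) + x2 a * x2 b + x3 a * x3 b.

(* The Lorentzian cross product; its last two coordinates are the opposites
   of the Euclidean ones. *)
Definition cross (a b : vec) : vec :=
  (x2 a * x3 b - x3 a * x2 b,
   x1 a * x3 b - x3 a * x1 b,
   x2 a * x1 b - x1 a * x2 b).

Definition vDerive (f : R -> vec) (s : R) : vec :=
  (Derive (fun u => x1 (f u)) s,
   Derive (fun u => x2 (f u)) s,
   Derive (fun u => x3 (f u)) s).

Definition smooth_on (D : R -> Prop) (f : R -> R) : Prop :=
  forall (n : nat) (s : R), D s -> ex_derive_n f n s.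

Definition vsmooth_on (D : R -> Prop) (f : R -> vec) : Prop :=
  smooth_on D (fun u => x1 (f u)) /\
  smooth_on D (fun u => x2 (f u)) /\
  smooth_on D (fun u => x3 (f u)).

(* Dual numbers a + eps a* and dual vectors, as pairs (real part, dual part). *)
Definition dual : Type := (R * R)%type.
Definition dvec : Type := (vec * vec)%type.

Definition re (a : dual) : R := fst a.
Definition du (a : dual) : R := snd a.

Definition dual_ext (f : R -> R) (a : dual) : dual :=
  (f (re a), du a * Derive f (re a)).

Definition dscal (a : dual) (X : dvec) : dvec :=
  (scal (re a) (fst X), plus (scal (re a) (snd X)) (scal (du a) (fst X))).

(* A ruled surface with base curve [base] and rulings directed by [ruling],
   over the open parameter interval (lo, hi), possibly unbounded.  Values of
   the two functions outside of that interval are irrelevant. *)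
Record ruled_surface := RuledSurface {
  lo : Rbar;
  hi : Rbar;
  base : R -> vec;
  ruling : R -> vec
}.

Definition dom (S : ruled_surface) (s : R) : Prop :=
  Rbar_lt (lo S) s /\ Rbar_lt s (hi S).

Definition ruled_map (S : ruled_surface) (s v : R) : vec :=
  plus (base S s) (scal v (ruling S s)).

(* The real frame {e, t, g}, parametrized by the arc-length of e. *)
Definition frame_e (S : ruled_surface) : R -> vec := ruling S.
Definition frame_t (S : ruled_surface) : R -> vec := vDerive (ruling S).
Definition frame_g (S : ruled_surface) (s : R) : vec :=
  opp (cross (frame_e S s) (frame_t S s)).

(* For spacelike e this is the gamma of g' = gamma t, as <t,t> = -1; for
   timelike e, where <t,t> = 1, it is the gamma of g' = - gamma t. *)
Definition conical_curvature (S : ruled_surface) (s : R) : R :=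
  - inner (vDerive (frame_g S) s) (frame_t S s).

(* The dual vector x + eps (c x x) of the line through c directed by x. *)
Definition tilde (S : ruled_surface) (x : R -> vec) (s : R) : dvec :=
  (x s, cross (base S s) (x s)).

Definition dual_e (S : ruled_surface) : R -> dvec := tilde S (frame_e S).
Definition dual_t (S : ruled_surface) : R -> dvec := tilde S (frame_t S).
Definition dual_g (S : ruled_surface) : R -> dvec := tilde S (frame_g S).

(* [eps_e] and [eps_t] are the causal characters of the ruling and of its
   derivative.  The condition on <t,t> makes s the arc-length of the
   indicatrix e, and the last one makes the base curve the striction curve. *)
Definition ruled_surface_with (eps_e eps_t : R) (S : ruled_surface) : Prop :=
  dom S 0 /\
  vsmooth_on (dom S) (base S) /\
  vsmooth_on (dom S) (ruling S) /\
  forall s, dom S s ->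
    inner (frame_e S s) (frame_e S s) = eps_e /\
    inner (frame_t S s) (frame_t S s) = eps_t /\
    inner (vDerive (base S) s) (frame_t S s) = 0.

Definition spacelike_ruled_surface : ruled_surface -> Prop :=
  ruled_surface_with 1 (-1).

Definition timelike_ruled_surface : ruled_surface -> Prop :=
  ruled_surface_with (-1) 1.

Definition correspondence (S S1 : ruled_surface) (s1 : R -> R) : Prop :=
  forall s, dom S s -> dom S1 (s1 s) /\ ex_derive s1 s /\ Derive s1 s <> 0.

Definition mannheim_offset (S S1 : ruled_surface) (s1 : R -> R) : Prop :=
  correspondence S S1 s1 /\
  forall s, dom S s -> dual_g S s = dual_t S1 (s1 s).

(* thetabar = theta + eps theta*, where theta is the offset angle and theta*
   the offset distance. *)
Definition dual_offset_angle (S S1 : ruled_surface) (s1 : R -> R)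
    (thetabar : R -> dual) : Prop :=
  forall s, dom S s ->
    dual_e S1 (s1 s) =
      plus (dscal (dual_ext sinh (thetabar s)) (dual_e S s))
           (dscal (dual_ext cosh (thetabar s)) (dual_t S s)) /\
    dual_g S1 (s1 s) =
      plus (dscal (dual_ext cosh (thetabar s)) (dual_e S s))
           (dscal (dual_ext sinh (thetabar s)) (dual_t S s)).

(* Main.v *)
(** Only the real parts of the dual relations matter.  Differentiating
    [t1 (s1 s) = g s] gives [s1' t1' = g'].  Pair this with [e1] and [g1]:
    on the [S1] side, [<e1, t1'> = - <t1, t1> = - 1] and
    [<g1, t1'> = - <g1', t1> = gamma1]; on the [S] side, [<e, g'> = 0], so with
    [k = <t, g'>] the hyperbolic rotation yields [- s1' = k cosh theta] and
    [s1' gamma1 = k sinh theta].  Dividing gives the result. *)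
Require Import Defs.
From Stdlib Require Import Reals Lra.
From Coquelicot Require Import Coquelicot.
Open Scope R_scope.

Definition ex_vderive (f : R -> vec) (s : R) : Prop :=
  ex_derive (fun u => x1 (f u)) s /\
  ex_derive (fun u => x2 (f u)) s /\
  ex_derive (fun u => x3 (f u)) s.

Lemma inner_comm (a b : vec) : inner a b = inner b a.
Proof. unfold inner; ring. Qed.

Lemma inner_plus_l (a b c : vec) : inner (plus a b) c = inner a c + inner b c.
Proof.
  destruct a as [[a1 a2] a3], b as [[b1 b2] b3].
  unfold inner, x1, x2, x3; cbn; unfold plus; cbn; ring.
Qed.

Lemma inner_scal_l (k : R) (a b : vec) : inner (scal k a) b = k * inner a b.
Proof.
  destruct a as [[a1 a2] a3].
  unfold inner, x1, x2, x3; cbn; unfold scal; cbn; unfold mult; cbn; ring.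
Qed.

(** The signs of [cross] match the signature: [inner a (cross b c)] is minus the Euclidean
    determinant of [a], [b], [c], which vanishes on a repeated vector. *)
Lemma inner_opp_cross_l (a b : vec) : inner a (opp (cross a b)) = 0.
Proof.
  destruct a as [[a1 a2] a3], b as [[b1 b2] b3].
  unfold cross, inner, x1, x2, x3; cbn; unfold opp; cbn; ring.
Qed.

Lemma inner_opp_cross_r (a b : vec) : inner b (opp (cross a b)) = 0.
Proof.
  destruct a as [[a1 a2] a3], b as [[b1 b2] b3].
  unfold cross, inner, x1, x2, x3; cbn; unfold opp; cbn; ring.
Qed.

Lemma is_derive_inner (f g : R -> vec) (s : R) :
  ex_vderive f s -> ex_vderive g s ->
  is_derive (fun u => inner (f u) (g u)) s
    (inner (vDerive f s) (g s) + inner (f s) (vDerive g s)).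
Proof.
  assert (Hreal : forall f1 f2 f3 g1 g2 g3 : R -> R,
    ex_derive f1 s /\ ex_derive f2 s /\ ex_derive f3 s ->
    ex_derive g1 s /\ ex_derive g2 s /\ ex_derive g3 s ->
    is_derive (fun u => - (f1 u * g1 u) + f2 u * g2 u + f3 u * g3 u) s
      (- (Derive f1 s * g1 s) + Derive f2 s * g2 s + Derive f3 s * g3 s
       + (- (f1 s * Derive g1 s) + f2 s * Derive g2 s + f3 s * Derive g3 s))).
  { intros f1 f2 f3 g1 g2 g3 (F1 & F2 & F3) (G1 & G2 & G3).
    auto_derive; [now repeat split |].
    (* [auto_derive] leaves eta-expanded functions under [Derive]; contracting them lets [ring]
       identify the atoms. *)
    change (fun x => ?h x) with h; ring. }
  intros Hf Hg.
  exact (Hreal _ _ _ _ _ _ Hf Hg).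
Qed.

(** The product rule, with constancy asked only near [s] because the frame relations hold only on
    the domain of a surface. *)
Lemma inner_vDerive_of_constant (f g : R -> vec) (k s : R) :
  ex_vderive f s -> ex_vderive g s ->
  locally s (fun u => inner (f u) (g u) = k) ->
  inner (vDerive f s) (g s) = - inner (f s) (vDerive g s).
Proof.
  intros Hf Hg Hk.
  assert (H : inner (vDerive f s) (g s) + inner (f s) (vDerive g s) = 0).
  { rewrite <- (is_derive_unique _ _ _ (is_derive_inner f g s Hf Hg)).
    rewrite <- (Derive_const k s); now apply Derive_ext_loc. }
  lra.
Qed.

Lemma vDerive_comp (f : R -> vec) (h : R -> R) (s : R) :
  ex_vderive f (h s) -> ex_derive h s ->
  vDerive (fun u => f (h u)) s = scal (Derive h s) (vDerive f (h s)).
Proof.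
  intros (F1 & F2 & F3) Hh.
  unfold vDerive.
  rewrite (Derive_comp (fun v => x1 (f v)) h), (Derive_comp (fun v => x2 (f v)) h),
    (Derive_comp (fun v => x3 (f v)) h) by assumption.
  reflexivity.
Qed.

Lemma vDerive_ext_loc (f g : R -> vec) (s : R) :
  locally s (fun u => f u = g u) -> vDerive f s = vDerive g s.
Proof.
  intros H; unfold vDerive.
  f_equal; [f_equal |]; apply Derive_ext_loc; revert H; apply filter_imp;
    intros u Hu; now rewrite Hu.
Qed.

Lemma ex_vderive_opp_cross (f g : R -> vec) (s : R) :
  ex_vderive f s -> ex_vderive g s ->
  ex_vderive (fun u => opp (cross (f u) (g u))) s.
Proof.
  assert (Hreal : forall a b c d : R -> R,
    ex_derive a s -> ex_derive b s -> ex_derive c s -> ex_derive d s ->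
    ex_derive (fun u => - (a u * b u - c u * d u)) s).
  { intros a b c d Ha Hb Hc Hd; auto_derive; now repeat split. }
  intros (F1 & F2 & F3) (G1 & G2 & G3).
  repeat split.
  - exact (Hreal _ _ _ _ F2 G3 F3 G2).
  - exact (Hreal _ _ _ _ F1 G3 F3 G1).
  - exact (Hreal _ _ _ _ F2 G1 F1 G2).
Qed.

(** Openness of the parameter interval is what allows identities on the domain to be
    differentiated. *)
Lemma dom_locally (S : ruled_surface) (s : R) : dom S s -> locally s (dom S).
Proof.
  intros [Hlo Hhi].
  apply filter_and; [now apply (open_Rbar_gt (lo S) s) | now apply (open_Rbar_lt (hi S) s)].
Qed.

Section Frame.

(** The causal characters stay arbitrary so that the identities below serve both the spacelike and
    the timelike surface. *)
Variables (eps_e eps_t : R) (S : ruled_surface).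
Hypothesis HS : ruled_surface_with eps_e eps_t S.

Lemma ex_vderive_frame_e (s : R) (Hs : dom S s) : ex_vderive (frame_e S) s.
Proof.
  destruct HS as (_ & _ & (E1 & E2 & E3) & _).
  exact (conj (E1 1%nat s Hs) (conj (E2 1%nat s Hs) (E3 1%nat s Hs))).
Qed.

Lemma ex_vderive_frame_t (s : R) (Hs : dom S s) : ex_vderive (frame_t S) s.
Proof.
  destruct HS as (_ & _ & (E1 & E2 & E3) & _).
  (* Second-order smoothness of the ruling unfolds to differentiability of its first derivative,
     which is [frame_t]. *)
  exact (conj (E1 2%nat s Hs) (conj (E2 2%nat s Hs) (E3 2%nat s Hs))).
Qed.

Lemma ex_vderive_frame_g (s : R) (Hs : dom S s) : ex_vderive (frame_g S) s.
Proof.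
  apply ex_vderive_opp_cross; [exact (ex_vderive_frame_e s Hs) | exact (ex_vderive_frame_t s Hs)].
Qed.

Lemma inner_e_t (s : R) (Hs : dom S s) : inner (frame_e S s) (frame_t S s) = 0.
Proof.
  assert (H : inner (vDerive (frame_e S) s) (frame_e S s)
              = - inner (frame_e S s) (vDerive (frame_e S) s)).
  { apply inner_vDerive_of_constant with eps_e; try exact (ex_vderive_frame_e s Hs).
    generalize (dom_locally S s Hs); apply filter_imp; intros u Hu.
    now apply HS. }
  rewrite inner_comm in H.
  change (vDerive (frame_e S) s) with (frame_t S s) in H.
  lra.
Qed.

(** Differentiate [<e,t> = 0] and use [e' = t]. *)
Lemma inner_e_vDerive_t (s : R) (Hs : dom S s) :
  inner (frame_e S s) (vDerive (frame_t S) s) = - eps_t.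
Proof.
  assert (H : inner (vDerive (frame_e S) s) (frame_t S s)
              = - inner (frame_e S s) (vDerive (frame_t S) s)).
  { apply inner_vDerive_of_constant with 0.
    - now apply ex_vderive_frame_e.
    - now apply ex_vderive_frame_t.
    - generalize (dom_locally S s Hs); apply filter_imp; intros u Hu.
      now apply inner_e_t. }
  change (vDerive (frame_e S) s) with (frame_t S s) in H.
  assert (Ht : inner (frame_t S s) (frame_t S s) = eps_t) by now apply HS.
  lra.
Qed.

(** Differentiating [<e,g> = 0] gives [<e,g'> = - <t,g>], and [g] is orthogonal to [t] as well. *)
Lemma inner_e_vDerive_g (s : R) (Hs : dom S s) :
  inner (frame_e S s) (vDerive (frame_g S) s) = 0.
Proof.
  assert (H : inner (vDerive (frame_e S) s) (frame_g S s)
              = - inner (frame_e S s) (vDerive (frame_g S) s)).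
  { apply inner_vDerive_of_constant with 0.
    - now apply ex_vderive_frame_e.
    - now apply ex_vderive_frame_g.
    - apply filter_forall; intros u; apply inner_opp_cross_l. }
  assert (Htg : inner (frame_t S s) (frame_g S s) = 0) by apply inner_opp_cross_r.
  change (vDerive (frame_e S) s) with (frame_t S s) in H.
  lra.
Qed.

(** Differentiating [<g,t> = 0] moves the derivative from [g] to [t], the vector whose derivative
    the offset condition controls on the second surface. *)
Lemma inner_g_vDerive_t (s : R) (Hs : dom S s) :
  inner (frame_g S s) (vDerive (frame_t S) s) = conical_curvature S s.
Proof.
  assert (H : inner (vDerive (frame_g S) s) (frame_t S s)
              = - inner (frame_g S s) (vDerive (frame_t S) s)).
  { apply inner_vDerive_of_constant with 0.
    - now apply ex_vderive_frame_g.
    - now apply ex_vderive_frame_t.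
    - apply filter_forall; intros u; rewrite inner_comm; apply inner_opp_cross_r. }
  unfold conical_curvature; lra.
Qed.

End Frame.

Theorem theorem5p6 (S S1 : ruled_surface) (s1 : R -> R) (thetabar : R -> dual)
    (HS : spacelike_ruled_surface S)
    (HS1 : timelike_ruled_surface S1)
    (Hoffset : mannheim_offset S S1 s1)
    (Hangle : dual_offset_angle S S1 s1 thetabar) :
  forall s : R, dom S s ->
    conical_curvature S1 (s1 s) = - tanh (re (thetabar s)).
Proof.
  intros s Hs.
  destruct Hoffset as [Hcorr Hgt].
  destruct (Hcorr s Hs) as (Hs1 & Hd & Hd0).
  destruct (Hangle s Hs) as [He1 Hg1].
  (* The real part of [dual_ext f] is [f] at the real part, so what remains is a hyperbolic rotation
     by the real angle. *)
  apply (f_equal fst) in He1; apply (f_equal fst) in Hg1.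
  change (frame_e S1 (s1 s) = plus (scal (sinh (re (thetabar s))) (frame_e S s))
                                   (scal (cosh (re (thetabar s))) (frame_t S s))) in He1.
  change (frame_g S1 (s1 s) = plus (scal (cosh (re (thetabar s))) (frame_e S s))
                                   (scal (sinh (re (thetabar s))) (frame_t S s))) in Hg1.
  set (theta := re (thetabar s)) in *.
  assert (Hg' : vDerive (frame_g S) s
                = scal (Derive s1 s) (vDerive (frame_t S1) (s1 s))).
  { rewrite <- vDerive_comp; [| now apply ex_vderive_frame_t with (-1) 1 | exact Hd].
    apply vDerive_ext_loc.
    generalize (dom_locally S s Hs); apply filter_imp; intros u Hu.
    exact (f_equal fst (Hgt u Hu)). }
  pose proof (inner_e_vDerive_t _ _ _ HS1 _ Hs1) as Het1.
  pose proof (inner_g_vDerive_t _ _ _ HS1 _ Hs1) as Hgt1.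
  pose proof (inner_e_vDerive_g _ _ _ HS _ Hs) as Heg.
  set (k := inner (frame_t S s) (vDerive (frame_g S) s)).
  (* Evaluate [<e1,g'>] twice: through [g' = s1' t1'], and through the expansion of [e1] in [e] and
     [t]. The next assertion does the same with [g1]. *)
  assert (Hcosh : - Derive s1 s = k * cosh theta).
  { transitivity (inner (frame_e S1 (s1 s)) (vDerive (frame_g S) s)).
    - rewrite Hg', inner_comm, inner_scal_l, inner_comm, Het1; ring.
    - rewrite He1, inner_plus_l, !inner_scal_l, Heg; unfold k; ring. }
  assert (Hsinh : Derive s1 s * conical_curvature S1 (s1 s) = k * sinh theta).
  { transitivity (inner (frame_g S1 (s1 s)) (vDerive (frame_g S) s)).
    - rewrite Hg', inner_comm, inner_scal_l, inner_comm, Hgt1; ring.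
    - rewrite Hg1, inner_plus_l, !inner_scal_l, Heg; unfold k; ring. }
  assert (Hc : cosh theta <> 0).
  (* Regularity of [s1] suffices here: a zero of [cosh theta] would force [s1' = 0]. *)
  { intros H; apply Hd0; rewrite H in Hcosh; lra. }
  apply Rmult_eq_reg_l with (Derive s1 s); [| exact Hd0].
  rewrite Hsinh.
  (* Both sides now carry the factor [k], so only [cosh theta] is divided by. *)
  replace (Derive s1 s) with (- (k * cosh theta)) by lra.
  unfold tanh; field; exact Hc.
Qed.
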